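(* Let $f\in K^{\times}$ be an iterated integral over $k$ and let $g\in K$ satisfy a nonzero homogeneous linear differential equation with coefficients in $k$. Assume that $k$ contains an element $x$ with $x'=1$, that $f$ is transcendental over $k$, and that $f$ and $g$ are algebraically dependent over $k$. Then $g\in k[f]$.
   Context: $K$ is a differential field of characteristic zero (derivation $y\mapsto y'$), $k\subset K$ is an algebraically closed differential subfield, and $K$ and $k$ have the same field of constants $C$. An element $f\in K$ is an iterated integral over $k$ if $f^{(n)}\in k$ for some $n\in\mathbb{N}$. *)

(* Defs.v *)
From HB Require Import structures.
From mathcomp Require Import all_boot all_order all_algebra.
Set Implicit Arguments. Unset Strict Implicit. Unset Printing Implicit Defensive.
Import Order.TTheory GRing.Theory.
Local Open Scope ring_scope.

Definition is_derivation (K : fieldType) (D : K -> K) : Prop :=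
  (forall a b, D (a + b) = D a + D b) /\
  (forall a b, D (a * b) = D a * b + a * D b).

Definition is_subfield (K : fieldType) (k : {pred K}) : Prop :=
  [/\ 0 \in k, 1 \in k,
      (forall a b, a \in k -> b \in k -> a - b \in k),
      (forall a b, a \in k -> b \in k -> a * b \in k) &
      (forall a, a \in k -> a^-1 \in k)].

Definition diff_closed (K : fieldType) (D : K -> K) (k : {pred K}) : Prop :=
  forall a, a \in k -> D a \in k.

Definition alg_closed_sub (K : fieldType) (k : {pred K}) : Prop :=
  forall p : {poly K}, p \is a polyOver k -> (1 < size p)%N ->
    exists2 z, z \in k & root p z.

Definition iterated_integral (K : fieldType) (D : K -> K) (k : {pred K}) (f : K) : Prop :=
  exists n : nat, iter n D f \in k.

Definition satisfies_lode (K : fieldType) (D : K -> K) (k : {pred K}) (g : K) : Prop :=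
  exists a : seq K, all (fun c => c \in k) a /\ has (fun c => c != 0) a /\
    \sum_(i < size a) a`_i * iter i D g = 0.

Definition transcendental_over (K : fieldType) (k : {pred K}) (f : K) : Prop :=
  forall p : {poly K}, p \is a polyOver k -> p.[f] = 0 -> p = 0.

Definition eval2 (K : fieldType) (P : {poly {poly K}}) (a b : K) : K :=
  (map_poly (fun q : {poly K} => q.[a]) P).[b].

Definition alg_dependent (K : fieldType) (k : {pred K}) (f g : K) : Prop :=
  exists P : {poly {poly K}}, P != 0 /\
    (forall i, P`_i \is a polyOver k) /\ eval2 P f g = 0.

Definition in_poly_ring (K : fieldType) (k : {pred K}) (f g : K) : Prop :=
  exists2 p : {poly K}, p \is a polyOver k & g = p.[f].

(* Main.v *)
(* Work with derivations of all of K: in characteristic 0 any derivation of a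
   subring extends to K, so y is algebraic over a subring S exactly when every
   derivation vanishing on S vanishes at y.

   Choose s minimal such that some derivation d kills k and all f^(i) with
   i >= s, but not f, and normalize it to d f^(s-1) = 1. The commutator [D, d]
   kills k and all f^(i) with i >= s-1, hence, by minimality of s, kills f and
   therefore g. So D^n (d f) = d (f^(n)) = 0, which makes v = d f a polynomial
   in x with constant coefficients, and all d^j g solve the linear equation of
   g. The solution space being finite-dimensional over the constants, q(d) g = 0
   for some nonzero q with constant coefficients. A nonzero constant c cannot be
   an eigenvalue of d on elements algebraic over k(f), as exponentials are
   transcendental; so d^r g = 0 for some r. With b = v^-1 d, which acts as d/df,
   this reads b^r g = 0, and g is a polynomial in f over k. *)
Require Import Defs.
From HB Require Import structures.
From mathcomp Require Import all_boot all_order all_algebra.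
From mathcomp Require Import ring zify boolp classical_sets.
Set Implicit Arguments. Unset Strict Implicit. Unset Printing Implicit Defensive.
Import Order.TTheory GRing.Theory.
Local Open Scope ring_scope.
Local Open Scope classical_set_scope.

(** * Derivations of a field and polynomials with constant coefficients *)

Lemma deriv_neq0 (R : idomainType) (p : {poly R}) :
  [pchar R] =i pred0 -> (1 < size p)%N -> p^`() != 0.
Proof.
move=> hchar s1; apply/eqP => /(congr1 (fun q : {poly R} => q`_(size p).-2)).
rewrite coef_deriv coef0 (_ : (size p).-2.+1 = (size p).-1); last by lia.
move/eqP; rewrite -mulr_natr mulf_eq0 lead_coef_eq0 -size_poly_eq0.
by rewrite (pcharf0P _).1 //; lia.
Qed.

Lemma size_root_gt1 (R : idomainType) (p : {poly R}) z :
  p != 0 -> p.[z] = 0 -> (1 < size p)%N.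
Proof. by move=> p0 /eqP pz; apply: root_size_gt1 p0 pz. Qed.

Section Derivation.
Variables (K : fieldType) (d : K -> K).
Hypothesis hd : is_derivation d.

Lemma derD a b : d (a + b) = d a + d b. Proof. exact: hd.1. Qed.

Lemma derM a b : d (a * b) = d a * b + a * d b. Proof. exact: hd.2. Qed.

Lemma der0 : d 0 = 0.
Proof. by apply: (addrI (d 0)); rewrite -derD !addr0. Qed.

Lemma der1 : d 1 = 0.
Proof. by apply: (addrI (d 1)); rewrite -[in RHS](mulr1 1) derM mulr1 mul1r addr0. Qed.

Lemma derN a : d (- a) = - d a.
Proof. by apply: (addrI (d a)); rewrite -derD !subrr der0. Qed.

Lemma derB a b : d (a - b) = d a - d b.
Proof. by rewrite derD derN. Qed.

Lemma derMn a n : d (a *+ n) = d a *+ n.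
Proof. by elim: n => [|n IH]; rewrite ?mulr0n ?der0 // !mulrS derD IH. Qed.

Lemma der_nat n : d n%:R = 0.
Proof. by rewrite derMn der1 mul0rn. Qed.

Lemma der_sum (I : Type) (r : seq I) (P : pred I) (F : I -> K) :
  d (\sum_(i <- r | P i) F i) = \sum_(i <- r | P i) d (F i).
Proof. exact: (big_morph d derD der0). Qed.

Lemma der_iterB n a b : iter n d (a - b) = iter n d a - iter n d b.
Proof. by elim: n => //= n ->; rewrite derB. Qed.

Lemma der_iterM_const n c a : d c = 0 -> iter n d (c * a) = c * iter n d a.
Proof. by move=> dc; elim: n => //= n ->; rewrite derM dc mul0r add0r. Qed.

Lemma derX a n : d (a ^+ n) = (a ^+ n.-1 * d a) *+ n.
Proof.
elim: n => [|n IH]; first by rewrite expr0 der1 mulr0n.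
rewrite exprS derM IH /=; case: n {IH} => [|n].
  by rewrite mulr0n mulr0 addr0 mulr1n mulrC.
by rewrite /= mulrnAr mulrA -exprS [d a * _]mulrC -mulrS.
Qed.

Lemma derV a : d a = 0 -> d a^-1 = 0.
Proof.
move=> da; have [->|a0] := eqVneq a 0; first by rewrite invr0 der0.
apply: (mulfI a0); have := der1; rewrite -(divff a0) derM da mul0r add0r => ->.
by rewrite mulr0.
Qed.

Lemma der_horner (p : {poly K}) z :
  (forall i, d p`_i = 0) -> d p.[z] = p^`().[z] * d z.
Proof.
elim/poly_ind: p => [|p c IH] dp; first by rewrite deriv0 !horner0 der0 mul0r.
have dpi i : d p`_i = 0.
  by have := dp i.+1; rewrite coefD coefMX coefC /= addr0.
have dc : d c = 0 by have := dp 0; rewrite coefD coefMX coefC /= add0r.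
rewrite derivD derivM derivX derivC !hornerE derD derM IH // dc.
ring.
Qed.

(** Differentiating p(z) = 0 gives p'(z) d z = 0. If p'(z) = 0, the argument restarts with p', which
    has smaller degree and is nonzero in characteristic 0. *)
Lemma der_algebraic (hchar : [pchar K] =i pred0) (p : {poly K}) z :
  p != 0 -> (forall i, d p`_i = 0) -> root p z -> d z = 0.
Proof.
have [n] := ubnP (size p); elim: n p => // n IH p; rewrite ltnS => sp p0 dp.
move/eqP=> pz; have /eqP := der_horner z dp.
rewrite pz der0 eq_sym mulf_eq0 => /orP[rz|/eqP//].
apply: (IH p^`()) => //; first exact: leq_trans (lt_size_deriv p0) sp.
- exact: deriv_neq0 hchar (size_root_gt1 p0 pz).
- by move=> i; rewrite coef_deriv derMn dp mul0rn.
Qed.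

Lemma der_scale c : is_derivation (fun y => c * d y).
Proof. by split=> a b; rewrite ?derD ?derM; ring. Qed.

End Derivation.

Lemma der_sub (K : fieldType) (d e : K -> K) :
  is_derivation d -> is_derivation e -> is_derivation (fun y => d y - e y).
Proof. by move=> hd he; split=> a b; rewrite ?(derD hd, derD he, derM hd, derM he); ring. Qed.

Lemma der_commutator (K : fieldType) (d e : K -> K) :
  is_derivation d -> is_derivation e ->
  is_derivation (fun y => d (e y) - e (d y)).
Proof.
move=> hd he; split=> a b; first by rewrite !(derD hd, derD he); ring.
by rewrite !(derM hd, derM he, derD hd, derD he); ring.
Qed.

(** * Extension of derivations from subrings to the whole field *)

Section Extension.
Variable K : fieldType.
Hypothesis hchar : [pchar K] =i pred0.

(** A derivation on a subring of [K], encoded as its graph so that chains have plain unions as upper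
    bounds. By additivity, the last clause makes the graph single-valued. *)
Definition der_graph (A : set (K * K)) : Prop :=
  [/\ A (1, 0),
      (forall a a' b b', A (a, a') -> A (b, b') -> A (a - b, a' - b')),
      (forall a a' b b', A (a, a') -> A (b, b') -> A (a * b, a' * b + a * b')) &
      (forall a', A (0, a') -> a' = 0)].

(** Here [q] arises from [p] by applying the partial derivation to each coefficient. *)
Definition coef_in (A : set (K * K)) (p q : {poly K}) : Prop :=
  forall i, A (p`_i, q`_i).

(** The chain rule forces these values once y is sent to w. *)
Definition graph_adjoin (A : set (K * K)) (y w : K) : set (K * K) :=
  [set z | exists p q, coef_in A p q /\ z = (p.[y], q.[y] + p^`().[y] * w)].

Section Graph.
Variable A : set (K * K).
Hypothesis hA : der_graph A.

Lemma graph0 : A (0, 0).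
Proof. by case: hA => A1 AB _ _; have := AB _ _ _ _ A1 A1; rewrite !subrr. Qed.

Lemma graphN a a' : A (a, a') -> A (- a, - a').
Proof.
by case: hA => _ AB _ _ Aa; have := AB _ _ _ _ graph0 Aa; rewrite !sub0r.
Qed.

Lemma graphD a a' b b' : A (a, a') -> A (b, b') -> A (a + b, a' + b').
Proof.
case: hA => _ AB _ _ Aa /graphN Ab.
by have := AB _ _ _ _ Aa Ab; rewrite !opprK.
Qed.

Lemma graph_sum (I : Type) (r : seq I) (F G : I -> K) :
  (forall i, A (F i, G i)) -> A (\sum_(i <- r) F i, \sum_(i <- r) G i).
Proof.
move=> AFG; elim: r => [|i r IH]; first by rewrite !big_nil; exact: graph0.
by rewrite !big_cons; exact: graphD.
Qed.

Lemma graphMn a a' n : A (a, a') -> A (a *+ n, a' *+ n).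
Proof.
move=> Aa; elim: n => [|n IH]; first by rewrite !mulr0n; exact: graph0.
by rewrite !mulrS; exact: graphD.
Qed.

Lemma coef_inC a a' : A (a, a') -> coef_in A a%:P a'%:P.
Proof. by move=> Aa i; rewrite !coefC; case: eqP => // _; exact: graph0. Qed.

Lemma coef_inXn n : coef_in A 'X^n 0.
Proof.
by move=> i; rewrite coefXn coef0; case: eqP => _; [case: hA | exact: graph0].
Qed.

Lemma coef_inB p q r s :
  coef_in A p q -> coef_in A r s -> coef_in A (p - r) (q - s).
Proof. by case: hA => _ AB _ _ pq rs i; rewrite !coefB; exact: AB. Qed.

Lemma coef_inM p q r s :
  coef_in A p q -> coef_in A r s -> coef_in A (p * r) (q * r + p * s).
Proof.
case: hA => _ _ AM _ pq rs i; rewrite coefD !coefM -big_split /=.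
by apply: graph_sum => j; exact: AM.
Qed.

Lemma coef_in_deriv p q : coef_in A p q -> coef_in A p^`() q^`().
Proof. by move=> pq i; rewrite !coef_deriv; exact: graphMn. Qed.

Lemma coef_in0 q : coef_in A 0 q -> q = 0.
Proof.
case: hA => _ _ _ A0 q0; apply/polyP => i; rewrite coef0; apply: A0.
by have := q0 i; rewrite coef0.
Qed.

(** This is what makes sending y to w well defined on polynomials in y. If y is transcendental over
    the domain of [A], any w works; otherwise a relation of minimal degree determines w, and
    pseudo-division carries the condition to all others. *)
Lemma coef_in_deriv_value y :
  exists w, forall p q, coef_in A p q -> p.[y] = 0 -> q.[y] + p^`().[y] * w = 0.
Proof.
have [|noroot] := pselect (exists n p q,
  [/\ coef_in A p q, p.[y] = 0, p != 0 & size p = n]); last first.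
  exists 0 => p q pq py; rewrite mulr0 addr0.
  suff p0 : p = 0 by move: pq; rewrite p0 => /coef_in0->; rewrite horner0.
  apply/eqP/negPn/negP => p0; apply: noroot.
  by exists (size p), p, q.
move=> /asboolP exn; pose good n := `[< exists p q,
  [/\ coef_in A p q, p.[y] = 0, p != 0 & size p = n] >].
have exg : exists n, good n by move/asboolP: exn => [n hn]; exists n; apply/asboolP.
(* [m'] is the coefficientwise image of [m] under the partial derivation, not its formal
   derivative. *)
case: (ex_minnP exg) => N /asboolP[m [m' [mm' my m0 sN]]] Nmin.
have minm p q : coef_in A p q -> p.[y] = 0 -> (size p < size m)%N -> p = 0.
  move=> pq py spm; apply/eqP/negPn/negP => p0.
  have /Nmin : good (size p) by apply/asboolP; exists p, q.
  by rewrite leqNgt -sN spm.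
have m1y : m^`().[y] != 0.
  apply/eqP => my'.
  have m'0 := minm _ _ (coef_in_deriv mm') my' (lt_size_deriv m0).
  by have := deriv_neq0 hchar (size_root_gt1 m0 my); rewrite m'0 eqxx.
have [w mw] : exists w, m'.[y] + m^`().[y] * w = 0.
  by exists (- m'.[y] / m^`().[y]); rewrite mulrCA divff // mulr1 subrr.
exists w => p q; have [n] := ubnP (size p).
elim: n p q => // n IH p q; rewrite ltnS => spn pq py.
have [p0|p0] := eqVneq p 0.
  by move: pq; rewrite p0 => /coef_in0->; rewrite deriv0 !horner0 mul0r addr0.
have smp : (size m <= size p)%N.
  by rewrite leqNgt; apply/negP => /(minm _ _ pq py) p00; rewrite p00 eqxx in p0.
pose c := lead_coef m; pose c' := m'`_(size m).-1.
pose l := lead_coef p; pose l' := q`_(size p).-1.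
pose k := (size p - size m)%N.
have cc' : coef_in A c%:P c'%:P by apply: coef_inC; exact: mm'.
have ll' : coef_in A l%:P l'%:P by apply: coef_inC; exact: pq.
(* The pseudo-remainder c p - l X^k m cancels the leading terms without division, the domain of [A]
   being only a ring. *)
have rr' := coef_inB (coef_inM cc' pq)
  (coef_inM (coef_inM ll' (coef_inXn k)) mm').
have [c0 l0] : c != 0 /\ l != 0 by rewrite !lead_coef_eq0.
set r := (X in coef_in A X _) in rr'.
have sm0 : (0 < size m)%N by rewrite lt0n size_poly_eq0.
have sr : (size r < n)%N.
  apply: leq_trans spn; rewrite (polySpred p0) ltnS; apply/leq_sizeP => j.
  rewrite leq_eqVlt => /orP[/eqP<-|jp].
    rewrite coefB -mulrA !coefCM coefXnM -/l.
    case: ltnP => [|_]; first by rewrite /k; lia.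
    by rewrite (_ : ((size p).-1 - k)%N = (size m).-1) 1?mulrC ?subrr // /k; lia.
  apply: nth_default; apply: leq_trans (size_polyD _ _) _.
  rewrite geq_max size_polyN -mulrA !size_Cmul // size_monicM ?monicXn ?size_polyXn //.
  move: jp smp sm0; rewrite /k; move: (size p) (size m) => a b; lia.
have ry : r.[y] = 0 by rewrite /r !hornerE py my; ring.
have := IH _ _ sr rr' ry.
(* As p and m vanish at y and the condition holds for m, the condition for r is c times the one for
   p. *)
rewrite /r !(derivB, derivM, derivC, derivXn) !hornerE py my.
move=> H; apply: (mulfI c0); rewrite mulr0 -[RHS]H.
have -> : m'.[y] = - (m^`().[y] * w) by apply/eqP; rewrite -addr_eq0 mw.
ring.
Qed.

Lemma graph_adjoinP y w :
  (forall p q, coef_in A p q -> p.[y] = 0 -> q.[y] + p^`().[y] * w = 0) ->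
  [/\ der_graph (graph_adjoin A y w), A `<=` graph_adjoin A y w &
      graph_adjoin A y w (y, w)].
Proof.
move=> hw; have AA' : A `<=` graph_adjoin A y w.
  move=> [a a'] Aa; exists a%:P, a'%:P; split; first exact: coef_inC.
  by rewrite derivC !hornerE.
split=> //; last first.
  exists 'X^1, 0; split; first exact: coef_inXn.
  by rewrite expr1 derivX !hornerE.
split.
- by apply: AA'; case: hA.
- move=> a a' b b' [p [q [pq [-> ->]]]] [r [s [rs [-> ->]]]].
  exists (p - r), (q - s); split; first exact: coef_inB.
  by rewrite derivB !hornerE; congr (_, _); ring.
- move=> a a' b b' [p [q [pq [-> ->]]]] [r [s [rs [-> ->]]]].
  exists (p * r), (q * r + p * s); split; first exact: coef_inM.
  by rewrite derivM !hornerE; congr (_, _); ring.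
- by move=> a' [p [q [pq [py ->]]]]; apply: hw.
Qed.

End Graph.

Lemma der_graph_extend (A0 : set (K * K)) : der_graph A0 ->
  exists2 d : K -> K, is_derivation d & forall a a', A0 (a, a') -> d a = a'.
Proof.
move=> hA0; pose P : set (set (K * K)) :=
  [set A | A = set0 \/ der_graph A /\ A0 `<=` A].
have [|A [[A_0|[hA A0A]] Amax]] := @Zorn_bigcup _ P.
- move=> F FP totF; have [Fne|Fe] := pselect (exists2 A, F A & A !=set0); last first.
    left; rewrite -subset0 => z [A FA Az]; apply: Fe; exists A => //.
    by exists z.
  right.
  have FG A : F A -> A !=set0 -> der_graph A /\ A0 `<=` A.
    by move=> FA [z Az]; case: (FP _ FA) => // A_0; rewrite A_0 in Az.
  have FG2 z1 z2 : (\bigcup_(X in F) X) z1 -> (\bigcup_(X in F) X) z2 ->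
    exists A, [/\ F A, der_graph A, A z1 & A z2].
    move=> [A FA Az1] [B FB Bz2].
    case: (totF _ _ FA FB) => AB.
      exists B; split => //; last exact: AB.
      by apply: (FG B FB _).1; exists z2.
    exists A; split => //; last exact: AB.
    by apply: (FG A FA _).1; exists z1.
  have [A FA Ane] := Fne; have [[A1 AB AM _] A0A] := FG A FA Ane.
  split; last by move=> z /A0A Az; exists A.
  split.
  + by exists A.
  + move=> a a' b b' ha hb; have [B [FB [_ BB _ _] Ba Bb]] := FG2 _ _ ha hb.
    by exists B => //; apply: BB.
  + move=> a a' b b' ha hb; have [B [FB [_ _ BM _] Ba Bb]] := FG2 _ _ ha hb.
    by exists B => //; apply: BM.
  + move=> a' ha; have [B [FB [_ _ _ B0] Ba _]] := FG2 _ _ ha ha.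
    exact: B0.
- exfalso; apply: (Amax A0); last by right; split.
  rewrite A_0; split; first by [].
  by case: hA0 => A1 _ _ _ /(_ _ A1).
have tot y : exists w, A (y, w).
  have [w hw] := coef_in_deriv_value hA y.
  have [hB AB Byw] := graph_adjoinP hA hw.
  exists w; apply: contrapT => nA; apply: (Amax (graph_adjoin A y w)).
    by split => // BA; apply: nA; exact: BA.
  by right; split => //; exact: subset_trans AB.
have [d dP] := choice tot.
have [A1 AB AM Af] := hA.
have funA a b c : A (a, b) -> A (a, c) -> b = c.
  move=> hb hc; have := AB _ _ _ _ hb hc; rewrite subrr => /Af /eqP.
  by rewrite subr_eq0 => /eqP.
exists d; last by move=> a a' /A0A; apply: funA.
by split=> a b; apply: funA (dP _) _; [apply: graphD | apply: AM].
Qed.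

(* The seed graph is [{(p(y), p'(y)) | p in S[X]}], that is, d/dy on S[y]. *)
Lemma der_transcendental (S : K -> Prop) (y : K) :
  S 1 -> (forall a b, S a -> S b -> S (a - b)) ->
  (forall a b, S a -> S b -> S (a * b)) ->
  (forall p : {poly K}, (forall i, S p`_i) -> p.[y] = 0 -> p = 0) ->
  exists d, [/\ is_derivation d, forall a, S a -> d a = 0 & d y = 1].
Proof.
move=> S1 SB SM tr; pose A : set (K * K) := [set z | S z.1 /\ z.2 = 0].
have hA : der_graph A.
  split=> //.
  - by move=> a a' b b' [/= Sa ->] [/= Sb ->]; split=> /=; [exact: SB|rewrite subrr].
  - move=> a a' b b' [/= Sa ->] [/= Sb ->]; split=> /=; first exact: SM.
    by rewrite mul0r mulr0 addr0.
  - by move=> a' [].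
have [|hB AB By] := graph_adjoinP hA (y := y) (w := 1).
  move=> p q pq py; have p0 : p = 0 by apply: tr => // i; have [] := pq i.
  move: pq; rewrite p0 => /(coef_in0 hA)->.
  by rewrite deriv0 !horner0 mul0r addr0.
have [d hd dB] := der_graph_extend hB.
by exists d; split=> // [a Sa|]; apply: dB => //; apply: AB.
Qed.

End Extension.

(** * Algebraic closure expressed through derivations *)

Section Closure.
Variable K : fieldType.
Implicit Types (S : set K) (d e : K -> K).

(** In characteristic 0, the algebraic closure in [K] of the field generated by [S]. *)
Definition der_closure S : set K :=
  [set y | forall e, is_derivation e -> (forall s, S s -> e s = 0) -> e y = 0].

Lemma sub_der_closure S : S `<=` der_closure S.
Proof. by move=> y Sy e _; apply. Qed.

Lemma der_closure_trans S T :
  S `<=` der_closure T -> der_closure S `<=` der_closure T.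
Proof. by move=> ST y Sy e he eT; apply: Sy => // s /ST; apply. Qed.

Lemma der_closureB S a b :
  der_closure S a -> der_closure S b -> der_closure S (a - b).
Proof. by move=> Sa Sb e he eS; rewrite (derB he) (Sa e) // (Sb e) // subrr. Qed.

Lemma der_closureM S a b :
  der_closure S a -> der_closure S b -> der_closure S (a * b).
Proof. by move=> Sa Sb e he eS; rewrite (derM he) (Sa e) // (Sb e) // mul0r mulr0 addr0. Qed.

Lemma der_closureV S a : der_closure S a -> der_closure S a^-1.
Proof. by move=> Sa e he eS; apply: derV => //; exact: Sa. Qed.

Lemma der_closure_nat S n : der_closure S n%:R.
Proof. by move=> e he _; exact: der_nat. Qed.

Lemma der_closure0 S : der_closure S 0.
Proof. by move=> e he _; exact: der0. Qed.

Lemma der_closure1 S : der_closure S 1.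
Proof. by move=> e he _; exact: der1. Qed.

Lemma der_closureX S a n : der_closure S a -> der_closure S (a ^+ n).
Proof. by move=> Sa e he eS; rewrite (derX he) (Sa e) // mulr0 mul0rn. Qed.

(* For y in the closure and e vanishing on S, e (d y) = [e, d] y, and [e, d]
   again vanishes on S. *)
Lemma der_closure_stable S d : is_derivation d ->
  (forall s, S s -> der_closure S (d s)) ->
  forall y, der_closure S y -> der_closure S (d y).
Proof.
move=> hd dS y Sy e he eS.
have := Sy _ (der_commutator he hd); rewrite (Sy e) // (der0 hd) subr0; apply.
by move=> s Ss; rewrite (dS s Ss e) // eS // (der0 hd) subr0.
Qed.

Lemma der_closure_iter S d n : is_derivation d ->
  (forall s, S s -> der_closure S (d s)) ->
  forall y, der_closure S y -> der_closure S (iter n d y).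
Proof. by move=> hd dS y Sy; elim: n => //= n; exact: der_closure_stable. Qed.

(** The commutator of [d] and [e] is a derivation vanishing on [S], hence on its closure, which the
    iterates of [d] do not leave. *)
Lemma der_closure_commute S d e n :
  is_derivation d -> is_derivation e ->
  (forall s, S s -> d (e s) = e (d s)) ->
  (forall s, S s -> der_closure S (d s)) ->
  forall y, der_closure S y -> e (iter n d y) = iter n d (e y).
Proof.
move=> hd he comm dS y Sy; elim: n => //= n <-; apply/eqP.
rewrite eq_sym -subr_eq0; apply/eqP.
apply: (der_closure_iter n hd dS Sy) (der_commutator hd he) _.
by move=> s Ss; rewrite comm // subrr.
Qed.

Lemma der_iterX_fact d f n :
  is_derivation d -> d f = 1 -> iter n d (f ^+ n) = n`!%:R.
Proof.
move=> hd df; elim: n => // n IH.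
rewrite iterSr (derX hd) df mulr1 /= -mulr_natl.
by rewrite (der_iterM_const hd) ?IH ?factS ?natrM //; exact: der_nat.
Qed.

(** Taylor expansion in f: c = d^r y is killed by [d] and d^r (c f^r / r!) = c, so subtracting this
    term lowers the order of nilpotency. *)
Lemma der_nilpotent_polynomial (hchar : [pchar K] =i pred0) S d f r y :
  is_derivation d -> (forall s, S s -> der_closure S (d s)) ->
  der_closure S f -> d f = 1 -> der_closure S y -> iter r d y = 0 ->
  exists p : {poly K},
    (forall i, der_closure S p`_i /\ d p`_i = 0) /\ y = p.[f].
Proof.
move=> hd dS Sf df; elim: r y => [|r IH] y Sy /=.
  move=> ->; exists 0; split=> [i|]; last by rewrite horner0.
  by rewrite coef0 (der0 hd); split=> //; exact: der_closure0.
set c := iter r d y => dc.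
have Sc : der_closure S c by exact: der_closure_iter.
pose b := c / r`!%:R.
have db : d b = 0.
  by rewrite (derM hd) dc mul0r add0r (derV hd) ?mulr0 //; exact: der_nat.
have Sb : der_closure S b.
  by apply: der_closureM => //; apply: der_closureV; exact: der_closure_nat.
have fact0 : r`!%:R != 0 :> K by rewrite (pcharf0P _).1 // -lt0n fact_gt0.
have [||p [Sp yp]] := IH (y - b * f ^+ r).
- by apply: der_closureB => //; apply: der_closureM => //; exact: der_closureX.
- rewrite (der_iterB hd) (der_iterM_const hd) // (der_iterX_fact _ hd) //.
  by rewrite divfK // subrr.
exists (p + b *: 'X^r); split; last by rewrite !hornerE -yp subrK.
move=> i; have [Spi dpi] := Sp i.
rewrite coefD coefZ coefXn; split; last first.
  by rewrite (derD hd) (derM hd) db dpi mul0r !add0r (der_nat hd) mulr0.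
rewrite -[X in der_closure S (_ + X)]opprK -[- (b * _)]sub0r.
apply: der_closureB => //; apply: der_closureB; first exact: der_closure0.
by apply: der_closureM => //; exact: der_closure_nat.
Qed.

End Closure.

Lemma eval2E (K : fieldType) (P : {poly {poly K}}) a b n : (size P <= n)%N ->
  eval2 P a b = \sum_(i < n) (P`_i).[a] * b ^+ i.
Proof.
move=> sP; rewrite /eval2 (@horner_coef_wide _ n).
  by apply: eq_bigr => i _; rewrite coef_map_id0 // horner0.
exact: leq_trans (size_poly _ _) sP.
Qed.

(** * Transcendence of exponentials: y behaves like exp(a f) *)

Section Exponential.
Variables (K : fieldType) (d : K -> K) (f a y : K).
Hypotheses (hchar : [pchar K] =i pred0) (hd : is_derivation d).
Hypotheses (df : d f = 1) (da : d a = 0) (a0 : a != 0).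
Hypotheses (dy : d y = a * y) (y0 : y != 0).

(* Applying [d - N a] to a relation of degree N in y strictly lowers the degree
   in f of its leading coefficient, so by induction the result is trivial. *)
Lemma exponential_transcendental (P : {poly {poly K}}) :
  (forall i j, d P`_i`_j = 0) -> eval2 P f y = 0 -> P = 0.
Proof.
have [m sP] : exists m, (size P <= m)%N by exists (size P).
(* The measure adds the sizes of all coefficients: the top one shrinks and the others do not
   grow. *)
have [n] := ubnP (\sum_(i < m) size (P`_i)%R)%N.
elim: n P sP => // n IH P sP; rewrite ltnS => meas dP Pfy.
apply/eqP/negPn/negP => P0; pose N := (size P).-1.
pose R : {poly {poly K}} :=
  \poly_(i < m) ((P`_i)^`() + ((i%:R - N%:R) * a) *: P`_i).
have sR : (size R <= m)%N by exact: size_poly.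
have coefR i : R`_i = (P`_i)^`() + ((i%:R - N%:R) * a) *: P`_i.
  rewrite coef_poly; case: ltnP => // mi.
  by rewrite nth_default ?deriv0 ?scaler0 ?addr0 //; exact: leq_trans mi.
have lcP : P`_N != 0 by rewrite -/(lead_coef P) lead_coef_eq0.
have Nm : (N < m)%N by rewrite prednK // lt0n size_poly_eq0.
have R0 : R = 0.
  apply: IH => //.
  - apply: leq_trans meas.
    rewrite (bigD1 (Ordinal Nm)) //= [in X in (_ < X)%N](bigD1 (Ordinal Nm)) //=.
    rewrite -addSn leq_add //.
      by rewrite coefR subrr mul0r scale0r addr0 lt_size_deriv.
    apply: leq_sum => i _; rewrite coefR; apply: leq_trans (size_polyD _ _) _.
    rewrite geq_max size_scale_leq andbT.
    have [->|Pi0] := eqVneq P`_i 0; first by rewrite deriv0.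
    exact/ltnW/lt_size_deriv.
  - move=> i j; rewrite coefR coefD coef_deriv coefZ (derD hd) (derMn hd) dP.
    rewrite !(derM hd) (derB hd) !(der_nat hd) dP da.
    by rewrite mul0rn subrr !(mul0r, mulr0, addr0).
  - suff -> : eval2 R f y = d (eval2 P f y) - N%:R * a * eval2 P f y.
      by rewrite Pfy (der0 hd) mulr0 subrr.
    rewrite (eval2E _ _ sR) (eval2E _ _ sP) (der_sum hd) mulr_sumr.
    rewrite -sumrB; apply: eq_bigr => i _; rewrite coefR !hornerE.
    rewrite (derM hd) (der_horner hd) // df (derX hd) dy.
    have -> : (y ^+ i.-1 * (a * y)) *+ i = i%:R * (a * y ^+ i).
      by case: (i : nat) => [|j] /=; rewrite ?mulr0n ?mul0r // -mulr_natl exprS; ring.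
    by rewrite /=; ring.
(* [R = 0] says P_i' = (N - i) a P_i, impossible by degree for a nonzero P_i with i < N. *)
have low i : (i < N)%N -> P`_i = 0.
  move=> iN; apply/eqP/negPn/negP => Pi0.
  have := coefR i; rewrite R0 coef0 => /esym/eqP; rewrite addr_eq0 => /eqP H.
  have := lt_size_deriv Pi0; rewrite H size_polyN size_scale ?ltnn //.
  rewrite mulf_neq0 // -oppr_eq0 opprB -natrB ?(ltnW iN) // (pcharf0P _).1 //.
  by rewrite subn_eq0 -ltnNge.
(* What remains is P_N(f) y^N = 0, so f is algebraic over the constants of [d], against d f = 1. *)
move: Pfy; rewrite (eval2E _ _ (leqnn _)) (polySpred P0) big_ord_recr /= -/N.
rewrite big1 ?add0r; last by move=> i _; rewrite low // horner0 mul0r.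
move/eqP; rewrite mulf_eq0 expf_eq0 (negPf y0) andbF orbF => rf.
have := der_algebraic hd hchar lcP (dP N) rf; rewrite df => /eqP.
by rewrite oner_eq0.
Qed.

(** By the previous lemma y is transcendental over C[f], with C the constants of [d]; so some
    derivation kills C and f and sends y to 1. *)
Lemma exponential_not_in_closure :
  ~ der_closure [set z | d z = 0 \/ z = f] y.
Proof.
move=> Qy; pose S z := exists p : {poly K}, (forall i, d p`_i = 0) /\ z = p.[f].
have SC z : d z = 0 -> S z.
  move=> dz; exists z%:P; rewrite hornerC; split=> // i.
  by rewrite coefC; case: eqP => // _; exact: der0.
have [||||e [he eS ey]] := der_transcendental hchar (S := S) (y := y).
- by apply: SC; exact: der1.
- move=> _ _ [p [dp ->]] [q [dq ->]]; exists (p - q); split; last by rewrite !hornerE.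
  by move=> i; rewrite coefB (derB hd) dp dq subrr.
- move=> _ _ [p [dp ->]] [q [dq ->]]; exists (p * q); split; last by rewrite !hornerE.
  move=> i; rewrite coefM (der_sum hd) big1 // => j _.
  by rewrite (derM hd) dp dq mul0r mulr0 addr0.
- move=> p Sp py; have [c hc] := choice Sp.
  pose P : {poly {poly K}} := \poly_(i < size p) c i.
  have coefP i : p`_i = (P`_i).[f].
    rewrite coef_poly; case: ltnP => [_|sp]; first exact: (hc i).2.
    by rewrite horner0 nth_default.
  have P0 : P = 0.
    apply: exponential_transcendental.
      move=> i j; rewrite coef_poly; case: ifP => _; first exact: (hc i).1.
      by rewrite coef0 (der0 hd).
    rewrite (eval2E _ _ (size_poly _ _)) -[RHS]py horner_coef.
    by apply: eq_bigr => i _; rewrite coefP.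
  by apply/polyP => i; rewrite coefP P0 !coef0 horner0.
have: e y = 0.
  apply: Qy => // z [/SC|->]; first exact: eS.
  apply: eS; exists 'X; rewrite hornerX; split=> // i.
  by rewrite coefX (der_nat hd).
by rewrite ey => /eqP; rewrite oner_eq0.
Qed.

End Exponential.

(** * Linear relations and linear differential equations *)

Section LinearCombination.
Variable K : fieldType.
Implicit Types (p q : {poly K}) (y : nat -> K).

(** For [y i = iter i d z] this is p(d) z, so that factoring [p] factors an operator. *)
Definition lincomb p y : K := \sum_(i < size p) p`_i * y i.

Lemma lincombE p y n : (size p <= n)%N -> lincomb p y = \sum_(i < n) p`_i * y i.
Proof.
move=> sp; rewrite /lincomb (big_ord_widen n (fun i => p`_i * y i)) // big_mkcond.
apply: eq_bigr => i _; case: ltnP => // pi.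
by rewrite nth_default // mul0r.
Qed.

Lemma lincomb_scale c p y : lincomb (c *: p) y = c * lincomb p y.
Proof.
rewrite (lincombE _ (size_scale_leq c p)) /lincomb mulr_sumr.
by apply: eq_bigr => i _; rewrite coefZ mulrA.
Qed.

(** The factor X - z acts on sequences as the shift minus z; on the iterates of [d], with d z = 0,
    this is the operator d - z. *)
Lemma lincomb_mul_XsubC q z y :
  lincomb (q * ('X - z%:P)) y = lincomb q (fun i => y i.+1 - z * y i).
Proof.
pose n := (size (q * ('X - z%:P))%R + size q)%N.
have sq : (size q <= n)%N by exact: leq_addl.
rewrite (lincombE _ (n := n.+1)); last by apply: leqW; exact: leq_addr.
rewrite (lincombE _ sq).
under eq_bigr => i _ do rewrite mulrBr coefB coefMX coefMC mulrBl.
rewrite sumrB big_ord_recl /= mul0r add0r.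
rewrite [X in _ - X]big_ord_recr /= [q`_n]nth_default // !mul0r addr0 -sumrB.
by apply: eq_bigr => i _; rewrite add0n /bump add1n mulrBr mulrA.
Qed.

(** Synthetic division: the coefficients of the quotient are computed from the top down. *)
Lemma coef_factor (S : K -> Prop) z q :
  S 0 -> (forall a b, S a -> S b -> S (a + b * z)) ->
  (forall i, S (q * ('X - z%:P))`_i) -> forall i, S q`_i.
Proof.
move=> S0 SD Sq i; have [n] : exists n, (size q <= i + n)%N.
  by exists (size q); exact: leq_addl.
elim: n i => [|n IH] i sq; first by rewrite nth_default // -[i]addn0.
have -> : q`_i = (q * ('X - z%:P))`_i.+1 + q`_i.+1 * z.
  by rewrite mulrBr coefB coefMX coefMC /= subrK.
by apply: SD => //; apply: IH; rewrite addSnnS.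
Qed.

Lemma underdetermined_relation r (W : nat -> nat -> K) :
  exists2 q : {poly K}, q != 0 &
    forall i, (i < r)%N -> lincomb q (fun j => W j i) = 0.
Proof.
pose M : 'M[K]_(r.+1, r) := \matrix_(j, i) W j i.
have : kermx M != 0.
  rewrite kermx_eq0 /row_free; apply/negP => /eqP rM.
  by have := rank_leq_col M; rewrite rM ltnn.
case/rowV0Pn => u /sub_kermxP uM u0.
exists (rVpoly u).
  by apply: contra u0 => /eqP u00; rewrite -[u]rVpolyK u00 linear0.
move=> i ir; rewrite (lincombE _ (size_poly _ _)).
have := congr1 (fun v : 'rV_r => v 0 (Ordinal ir)) uM; rewrite !mxE => H.
rewrite -[RHS]H.
by apply: eq_bigr => j _; rewrite coef_rVpoly_ord mxE.
Qed.

(* A relation of minimal length, made monic, has constant coefficients: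
   differentiating it yields a shorter one. *)
Lemma lode_solutions_dependent (D : K -> K) (a : {poly K}) y :
  is_derivation D -> a != 0 ->
  (forall j, lincomb a (fun i => iter i D (y j)) = 0) ->
  exists q, [/\ q != 0, forall i, D q`_i = 0 & lincomb q y = 0].
Proof.
move=> hD a0 ha; pose r := (size a).-1.
(* A relation between the columns of the Wronskian matrix with r rows, r being the order of the
   equation. *)
pose rel q := forall i, (i < r)%N -> lincomb q (fun j => iter i D (y j)) = 0.
pose good n := `[< exists q, [/\ q != 0, size q = n & rel q] >].
have exg : exists n, good n.
  have [q q0 hq] := underdetermined_relation r (fun j i => iter i D (y j)).
  by exists (size q); apply/asboolP; exists q.
case: (ex_minnP exg) => n /asboolP[q1 [q10 sq1 rq1]] nmin.
pose q := (lead_coef q1)^-1 *: q1.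
have lc0 : (lead_coef q1)^-1 != 0 by rewrite invr_eq0 lead_coef_eq0.
have q0 : q != 0 by rewrite scaler_eq0 negb_or lc0.
have sq : size q = n by rewrite size_scale.
(* Row r is included because the equation expresses D^r (y j) through the lower rows;
   differentiating row r - 1 needs it. *)
have rq i : (i <= r)%N -> lincomb q (fun j => iter i D (y j)) = 0.
  rewrite leq_eqVlt => /orP[/eqP->|ir]; last by rewrite lincomb_scale rq1 // mulr0.
  have ar : a`_r != 0 by rewrite lead_coef_eq0.
  apply: (mulfI ar); rewrite mulr0.
  have : \sum_(i < size a) a`_i * lincomb q (fun j => iter i D (y j)) = 0.
    under eq_bigr => k _ do rewrite /lincomb mulr_sumr.
    rewrite exchange_big big1 //= => j _.
    transitivity (q`_j * lincomb a (fun k => iter k D (y j))); last by rewrite ha mulr0.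
    by rewrite /lincomb mulr_sumr; apply: eq_bigr => k _; rewrite mulrCA.
  rewrite (polySpred a0) big_ord_recr /= big1 ?add0r // => k _.
  by rewrite lincomb_scale rq1 // !mulr0.
exists q; split=> //; last exact: (rq 0).
pose dq : {poly K} := \poly_(j < n) D q`_j.
have lcq : q`_n.-1 = 1.
  by rewrite -sq /q coefZ size_scale // mulVf // lead_coef_eq0.
have n0 : (0 < n)%N by rewrite -sq lt0n size_poly_eq0.
have sdq : (size dq < n)%N.
  rewrite -[X in (_ < X)%N](prednK n0) ltnS; apply/leq_sizeP => j nj.
  rewrite coef_poly; case: ltnP => // jn.
  have -> : j = n.-1 by lia.
  by rewrite lcq (der1 hD).
have rdq : rel dq.
  move=> i ir; have := congr1 D (rq i (ltnW ir)).
  rewrite (der0 hD) /lincomb (der_sum hD) => H; rewrite -[RHS]H.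
  under [in RHS]eq_bigr => j _ do rewrite (derM hD).
  rewrite big_split /=.
  have := rq i.+1 ir; rewrite /lincomb /= => ->; rewrite addr0.
  rewrite -/(lincomb dq (fun j => iter i D (y j))) (lincombE _ (ltnW sdq)) sq.
  by apply: eq_bigr => j _; rewrite coef_poly ltn_ord.
have dq0 : dq = 0.
  apply/eqP/negPn/negP => dq0; have : good (size dq) by apply/asboolP; exists dq.
  by move=> /nmin; rewrite leqNgt sdq.
move=> i; have := congr1 (fun p : {poly K} => p`_i) dq0.
rewrite coef0 coef_poly; case: ltnP => // ni _.
by rewrite nth_default ?sq // (der0 hD).
Qed.

End LinearCombination.

(** * Algebraically closed subfields and operators with constant coefficients *)

Lemma polyOver_subfieldP (K : fieldType) (k : {pred K}) (p : {poly K}) :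
  0 \in k -> reflect (forall i, p`_i \in k) (p \is a polyOver k).
Proof.
move=> k0; apply: (iffP (all_nthP 0)) => [kp i|kp i _]; last exact: kp.
by have [/kp //|/(nth_default 0)->] := ltnP i (size p).
Qed.

Section Subfield.
Variables (K : fieldType) (k : {pred K}).
Hypothesis hk : is_subfield k.

Lemma subfield0 : 0 \in k. Proof. by case: hk. Qed.

Lemma subfieldM a b : a \in k -> b \in k -> a * b \in k.
Proof. by case: hk => _ _ _ kM _; exact: kM. Qed.

Lemma subfieldD a b : a \in k -> b \in k -> a + b \in k.
Proof.
case: hk => k0 _ kB _ _ ka kb; rewrite -[b]opprK; apply: (kB) => //.
by rewrite -sub0r; exact: kB.
Qed.

Lemma subfield_horner (p : {poly K}) x :
  (forall i, p`_i \in k) -> x \in k -> p.[x] \in k.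
Proof.
move=> kp kx; rewrite horner_coef; apply: (big_ind (fun z => z \in k)) => //.
- exact: subfield0.
- exact: subfieldD.
- move=> i _; apply: subfieldM => //; elim: (i : nat) => [|n IH].
    by rewrite expr0; case: hk.
  by rewrite exprS; exact: subfieldM.
Qed.

(** A nonconstant p has a root z in k, and y differs from z, so X - z can be divided out of the
    relation. *)
Lemma alg_closed_sub_transcendental y : alg_closed_sub k -> y \notin k ->
  forall p : {poly K}, (forall i, p`_i \in k) -> p.[y] = 0 -> p = 0.
Proof.
move=> kalg yk p; have [n] := ubnP (size p); elim: n p => // n IH p.
rewrite ltnS => sp kp py; apply/eqP/negPn/negP => p0.
have [] := kalg p; first by apply/polyOver_subfieldP => //; exact: subfield0.
  exact: size_root_gt1 p0 py.
move=> z kz /factor_theorem[q pq].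
have q0 : q != 0 by apply: contra p0 => /eqP q0; rewrite pq q0 mul0r.
have yz : y - z != 0.
  by rewrite subr_eq0; apply: contra yk => /eqP->.
suff q00 : q = 0 by rewrite q00 eqxx in q0.
apply: IH.
- apply: leq_trans sp; rewrite pq size_Mmonic ?monicXsubC // size_XsubC addn2.
  by rewrite /= ltnS.
- apply: (coef_factor (z := z) (S := fun c => c \in k)); first exact: subfield0.
    by move=> a b ka kb; apply: subfieldD => //; exact: subfieldM.
  by move=> i; rewrite -pq.
- by apply: (mulIf yz); rewrite mul0r -py pq !hornerE.
Qed.

Lemma alg_closed_sub_derivation y : [pchar K] =i pred0 ->
  alg_closed_sub k -> y \notin k ->
  exists e, [/\ is_derivation e, forall c, c \in k -> e c = 0 & e y = 1].
Proof.
move=> hchar kalg yk; have [_ k1 kB kM _] := hk.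
apply: (der_transcendental hchar (S := fun c => c \in k)) => //.
exact: alg_closed_sub_transcendental.
Qed.

(* If y were not in k, some e would kill k and map y to 1, and then
   e - (e f) d would kill k and f, but not y. *)
Lemma der_closure_constant (d : K -> K) f y : [pchar K] =i pred0 ->
  alg_closed_sub k -> is_derivation d -> (forall c, c \in k -> d c = 0) ->
  d f = 1 -> der_closure [set z | z \in k \/ z = f] y -> d y = 0 -> y \in k.
Proof.
move=> hchar kalg hd dk df Sy dy; apply/negPn/negP => yk.
have [e [he ek ey]] := alg_closed_sub_derivation hchar kalg yk.
have := Sy _ (der_sub he (der_scale hd (e f))).
rewrite /= ey dy mulr0 subr0 => H; have /eqP : 1 = 0 :> K.
  by apply: H => z [kz|->]; [rewrite ek // dk // mulr0 subrr | rewrite df mulr1 subrr].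
by rewrite oner_eq0.
Qed.

End Subfield.

(* Peel off the roots c of q one at a time: for c <> 0 the operator d - c is
   injective on S. *)
Lemma constant_operator_nilpotent (K : fieldType) (D d : K -> K) (k : {pred K})
  (S : set K) (q : {poly K}) y :
  [pchar K] =i pred0 -> is_derivation D -> is_derivation d ->
  is_subfield k -> alg_closed_sub k ->
  (forall c, D c = 0 -> c \in k) -> (forall c, c \in k -> d c = 0) ->
  (forall a b, S a -> S b -> S (a - b)) ->
  (forall c a, c \in k -> S a -> S (c * a)) ->
  (forall a, S a -> S (d a)) ->
  (forall c a, c \in k -> c != 0 -> S a -> d a = c * a -> a = 0) ->
  q != 0 -> (forall i, D q`_i = 0) -> S y ->
  lincomb q (fun i => iter i d y) = 0 -> exists r, iter r d y = 0.
Proof.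
move=> hchar hD hd hk kalg hconst dk SB SM Sd Sexp.
have [n] := ubnP (size q); elim: n q y => // n IH q y.
rewrite ltnS => sq q0 Dq Sy qy.
have [s1|s1] := leqP (size q) 1.
  exists 0; move: q0 qy; rewrite (lincombE _ s1) big_ord1 /=.
  rewrite {1}(size1_polyC s1) polyC_eq0 => q0 /eqP.
  by rewrite mulf_eq0 (negPf q0) => /eqP.
have [z kz rz] : exists2 z, z \in k & root q z.
  apply: kalg => //; apply/polyOver_subfieldP; first exact: subfield0 hk.
  by move=> i; exact: hconst.
have Dz : D z = 0 := der_algebraic hD hchar q0 Dq rz.
have /factor_theorem[p qp] := rz.
have p0 : p != 0 by apply: contra q0 => /eqP p0; rewrite qp p0 mul0r.
have [|||||r] := IH p (d y - z * y).
- apply: leq_trans sq; rewrite qp size_Mmonic ?monicXsubC // size_XsubC addn2.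
  by rewrite /= ltnS.
- exact: p0.
- apply: (coef_factor (z := z) (S := fun c => D c = 0)); first exact: der0.
    by move=> a b Da Db; rewrite (derD hD) (derM hD) Da Db Dz mul0r mulr0 !addr0.
  by move=> i; rewrite -qp.
- by apply: SB; [exact: Sd | exact: SM].
- rewrite -[RHS]qy qp lincomb_mul_XsubC; apply: eq_bigr => i _.
  by rewrite (der_iterB hd) -iterSr (der_iterM_const hd) ?dk.
(* Now d^r y is an eigenvector of [d] for z or zero: one more [d] kills it if z = 0, and it vanishes
   already if z is nonzero. *)
rewrite (der_iterB hd) -iterSr (der_iterM_const hd) ?dk // => /eqP.
rewrite subr_eq0 /= => /eqP H.
have [z0|z0] := eqVneq z 0; first by exists r.+1; rewrite /= H z0 mul0r.
by exists r; apply: Sexp H => //; elim: r => //= r; exact: Sd.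
Qed.

(** * The derivation attached to f, and the descent of g to [k[f]] *)

Unset Implicit Arguments.

Theorem theorem28 (K : fieldType) (D : K -> K) (k : {pred K})
  (hD : is_derivation D)
  (hchar : [pchar K] =i pred0)
  (hk : is_subfield k) (hkD : diff_closed D k) (hkalg : alg_closed_sub k)
  (hconst : forall c : K, D c = 0 -> c \in k)
  (f g : K)
  (hf0 : f != 0)
  (hf : iterated_integral D k f)
  (hg : satisfies_lode D k g)
  (hx : exists2 x : K, x \in k & D x = 1)
  (htr : transcendental_over k f)
  (hdep : alg_dependent k f g) :
  in_poly_ring k f g.
Proof.
have k0 := subfield0 hk.
have [n0 hn0] := hf.
pose good s := `[< exists d, [/\ is_derivation d, forall c, c \in k -> d c = 0,
  d f != 0 & forall i, (s <= i)%N -> d (iter i D f) = 0] >].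
have exg : exists s, good s.
  have fk : f \notin k.
    apply/negP => fk; have /eqP : 'X - f%:P = 0.
      apply: htr; last by rewrite !hornerE subrr.
      apply/(polyOver_subfieldP _ k0) => i; case: hk => _ k1 kB _ _.
      rewrite coefB coefX coefC; apply: kB; by case: eqP.
    by rewrite polyXsubC_eq0.
  have [e [he ek ef]] := alg_closed_sub_derivation hk hchar hkalg fk.
  exists n0; apply/asboolP; exists e; split=> //; first by rewrite ef oner_neq0.
  move=> i ni; apply: ek; rewrite -(subnK ni) iterD.
  by elim: (i - n0)%N => //= j; exact: hkD.
(* The minimal s is not 0, since i = 0 would give d f = 0; so s = t + 1, and f^(t) is the element to
   normalize at. *)
case: (ex_minnP exg) => -[|t].
  by move=> /asboolP[e [_ _ + /(_ 0 isT)/= ef]]; rewrite ef eqxx.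
move=> /asboolP[e [he ek ef eit]] tmin.
pose u := iter t D f.
have tmin' d : is_derivation d -> (forall c, c \in k -> d c = 0) ->
    (forall i, (t <= i)%N -> d (iter i D f) = 0) -> d f = 0.
  move=> hd dk dit; apply/eqP/negPn/negP => df.
  by have /tmin : good t; [apply/asboolP; exists d | rewrite ltnn].
(* Otherwise [e] would already be admissible at level t, against minimality. *)
have eu : e u != 0.
  apply: contra ef => /eqP eu; apply/eqP; apply: tmin' => // i.
  by rewrite leq_eqVlt => /orP[/eqP<-//|]; exact: eit.
pose d y := (e u)^-1 * e y.
have hd : is_derivation d by exact: der_scale.
have dk c : c \in k -> d c = 0 by move=> kc; rewrite /d (ek c) // mulr0.
have du : d u = 1 by rewrite /d mulVf.
have dit i : (t < i)%N -> d (iter i D f) = 0 by move=> ti; rewrite /d (eit i) // mulr0.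
(* The closures of [S] and [T] are the elements algebraic over k(f^(t), f^(t+1), ...) and over k(f).
   Minimality puts f, hence all of the second, into the first. *)
pose S : set K := [set z | z \in k \/ exists2 i, (t <= i)%N & z = iter i D f].
pose T : set K := [set z | z \in k \/ z = f].
have Sf : der_closure S f.
  move=> a ha aS; apply: tmin' => // [c kc|i ti]; apply: aS; first by left.
  by right; exists i.
have TS : T `<=` der_closure S.
  by move=> z [kz|->//]; apply: sub_der_closure; left.
have SD z : S z -> der_closure S (D z).
  move=> [kz|[i ti ->]]; apply: sub_der_closure; first by left; exact: hkD.
  by right; exists i.+1 => //; exact: leqW.
(* Both sides are 0: on [S] the values of [d] are 0 and 1, and [D] maps [S] into k and the f^(i)
   with i > t. *)
have comm z : S z -> D (d z) = d (D z).
  move=> [kz|[i ti ->]]; first by rewrite !dk ?(der0 hD) //; exact: hkD.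
  rewrite -[D (iter _ _ _)]/(iter i.+1 D f) [RHS]dit //.
  move: ti; rewrite leq_eqVlt => /orP[/eqP<-|ti]; first by rewrite du (der1 hD).
  by rewrite dit // (der0 hD).
have dD n z : der_closure S z -> d (iter n D z) = iter n D (d z).
  exact: (der_closure_commute n hD hd comm SD).
pose v := d f.
have v0 : v != 0 by rewrite mulf_neq0 // invr_eq0.
(* D^n0 v = d (f^(n0)) = 0 as f^(n0) lies in k. The Taylor expansion is then taken for [D] and x;
   [setT] makes its closure conditions vacuous. *)
have vk : v \in k.
  have [x kx Dx] := hx.
  have [||||||p [Sp ->]] := @der_nilpotent_polynomial K hchar setT D x n0 v => //.
  - by move=> z _; exact: sub_der_closure.
  - exact: sub_der_closure.
  - exact: sub_der_closure.
  - by rewrite -dD // dk.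
  by apply: (subfield_horner hk) => // i; apply: hconst; case: (Sp i).
have dv : d v = 0 by exact: dk.
have ST z : T z -> der_closure T (d z).
  case=> [kz|->]; first by rewrite dk //; exact: der_closure0.
  by apply: sub_der_closure; left.
(* Transcendence of f keeps the relation for g nonzero after substituting f, and its coefficients
   P_i(f) are killed with k and f. *)
have Tg : der_closure T g.
  move=> a ha aT; have [P [P0 [Pk Pfg]]] := hdep.
  have kP i j : P`_i`_j \in k by exact: (polyOver_subfieldP _ k0 (Pk i)).
  have coefg i : (map_poly (fun q : {poly K} => q.[f]) P)`_i = (P`_i).[f].
    by rewrite coef_map_id0 // horner0.
  apply: (der_algebraic ha hchar (p := map_poly (fun q : {poly K} => q.[f]) P)).
  - apply: contra P0 => /eqP P0; apply/eqP/polyP => i; rewrite coef0.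
    by apply: htr => //; rewrite -coefg P0 coef0.
  - move=> i; rewrite coefg (der_horner ha) => [|j]; last by apply: aT; left.
    by rewrite (aT f) ?mulr0 //; right.
  - exact/eqP.
have Sg : der_closure S g by exact: (der_closure_trans TS).
have [a [ka [a0 ag]]] := hg.
pose A := Poly a.
have A0 : A != 0.
  apply: contraTneq a0 => A0; rewrite -all_predC; apply/(all_nthP 0) => i _ /=.
  by rewrite negbK -coef_Poly -/A A0 coef0.
have Ak i : A`_i \in k.
  rewrite coef_Poly; have [ia|ia] := ltnP i (size a); last by rewrite nth_default.
  by apply: (allP ka); exact: mem_nth.
have Lg j : der_closure S (iter j d g) /\
    lincomb A (fun i => iter i D (iter j d g)) = 0.
  elim: j => [|j [Sj Lj]].
    split=> //; rewrite (lincombE _ (size_Poly a)) -[RHS]ag.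
    by apply: eq_bigr => i _; rewrite coef_Poly.
  split.
    apply: (der_closure_stable hd) Sj => z [kz|[i ti ->]].
      by rewrite dk //; exact: der_closure0.
    move: ti; rewrite leq_eqVlt => /orP[/eqP<-|ti].
      by rewrite du; exact: der_closure1.
    by rewrite dit //; exact: der_closure0.
  (* Applying [d] to the equation yields it for the next iterate: [d] kills its coefficients and
     commutes with [D] on the closure of [S]. *)
  have := congr1 d Lj; rewrite (der0 hd) /lincomb (der_sum hd) => H.
  rewrite -[RHS]H; apply: eq_bigr => i _.
  by rewrite (derM hd) dk // mul0r add0r dD.
have [q [q0 Dq qg]] := lode_solutions_dependent (y := fun j => iter j d g)
  hD A0 (fun j => (Lg j).2).
pose b y := v^-1 * d y.
have hb : is_derivation b by exact: der_scale.
have bk c : c \in k -> b c = 0 by move=> kc; rewrite /b (dk c) // mulr0.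
have bf : b f = 1 by rewrite /b mulVf.
have [||||r dg] := constant_operator_nilpotent (S := der_closure T)
  hchar hD hd hk hkalg hconst dk _ _ _ _ q0 Dq Tg qg.
- exact: der_closureB.
- by move=> c z kc Tz; apply: der_closureM => //; apply: sub_der_closure; left.
- exact: (der_closure_stable hd).
(* In terms of [b] the eigenvector satisfies b z = (c / v) z with b f = 1, so it would be an
   exponential algebraic over k(f). *)
- move=> c z kc c0 Tz dz; apply/eqP/negPn/negP => z0.
  apply: (exponential_not_in_closure (d := b) (f := f) (a := v^-1 * c) (y := z)) => //.
  + apply: bk; apply: (subfieldM hk) => //.
    by case: hk => _ _ _ _; apply.
  + by rewrite mulf_neq0 // invr_eq0.
  + by rewrite /b dz mulrA.
  + apply: der_closure_trans Tz => s [ks|->]; apply: sub_der_closure; last by right.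
    by left; exact: bk.
(* Since d v = 0, the factor v commutes with [d], and nilpotency on g passes from [d] to [b]. *)
have dE z n : iter n d z = v ^+ n * iter n b z.
  elim: n => [|n /= ->]; first by rewrite mul1r.
  rewrite (derM hd) (derX hd) dv mulr0 mul0rn mul0r add0r exprSr -mulrA.
  by rewrite -[d (iter n b z)](mulVKf v0).
have [|||p [Tp ->]] := der_nilpotent_polynomial (S := T) (y := g) (r := r) hchar hb _ _ bf Tg.
- move=> z [kz|->]; first by rewrite bk //; exact: der_closure0.
  by rewrite bf; exact: der_closure1.
- by apply: sub_der_closure; right.
- by apply: (mulfI (expf_neq0 r v0)); rewrite -dE dg mulr0.
exists p => //; apply/(polyOver_subfieldP _ k0) => i.
by have [Ti bi] := Tp i; exact: (der_closure_constant hk hchar hkalg hb bk bf Ti bi).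
Qed.
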